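(* Suppose $\mathsf R(0),\widehat{\mathsf B}_{44}(0)>0$, $(X^\star)^\top KX^\star>0$, $\sup_{t\ge0}\mathsf R^{\mathrm{Adv}}(t)<\infty$, $\delta>0$ and $q(t)\to q_\infty\in(0,\infty)$ as $t\to\infty$. If $\delta\le\sqrt{\lambda^+_{\min}/r_\star}$, where $r_\star\approx8.35\times10^{-5}$, then $q_\infty$ is the unique fixed point satisfying the fixed point equation $$q_\infty^2=\big(1-G(q_\infty)C_{\mathsf R}(q_\infty)\big)\frac{L_\infty(q_\infty)}{2F_\infty(q_\infty)}+\frac12G(q_\infty)C_{\mathsf B}(q_\infty)$$ and the admissibility condition $G(q_\infty)C_{\mathsf R}(q_\infty)<1$. The limiting values of $\mathsf R,\widehat{\mathsf B}_{44},\mathsf R^{\mathrm{Adv}}$ as $t\to\infty$ are given by $$\mathsf R(\infty)=\frac{F_\infty(q_\infty)}{1-G(q_\infty)C_{\mathsf R}(q_\infty)},\qquad\widehat{\mathsf B}_{44}(\infty)=2q_\infty^2\mathsf R(\infty),\qquad\mathsf R^{\mathrm{Adv}}(\infty)=G(q_\infty)\mathsf R(\infty).$$ Here, with $x_j^\star=\langle X^\star,\omega_j\rangle$, $$G(q)=1+2\delta\sqrt{\tfrac2\pi}q+\delta^2q^2,\quad D_j(q)=\lambda_j\Big(1+\delta\sqrt{\tfrac2\pi}q\Big)+\delta^2+\delta\sqrt{\tfrac2\pi}\frac1q,\quad \tilde\lambda^{\mathrm{eff}}(q)=\frac{\delta^2+\delta\sqrt{2/\pi}\,q^{-1}}{1+\delta\sqrt{2/\pi}\,q},$$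 $$C_{\mathsf R}(q)=\frac\gamma{2d}\sum_{j=1}^d\frac{\lambda_j^2}{D_j(q)},\quad C_{\mathsf B}(q)=\frac\gamma d\sum_{j=1}^d\frac{\lambda_j}{D_j(q)},$$ $$F_\infty(q)=\frac12\sum_{j=1}^d\lambda_j\Big(\frac{\tilde\lambda^{\mathrm{eff}}(q)}{\lambda_j+\tilde\lambda^{\mathrm{eff}}(q)}\Big)^2(x_j^\star)^2,\quad L_\infty(q)=\sum_{j=1}^d\Big(\frac{\lambda_j}{\lambda_j+\tilde\lambda^{\mathrm{eff}}(q)}\Big)^2(x_j^\star)^2.$$
   Context: Setting: $\ell_2$-adversarial least squares on a single class $a\sim\mathcal N(0,K)$, with target $(X^\star)^\top a+\epsilon$, $\epsilon\sim\mathcal N(0,\eta^2)$ independent of $a$; $K\in\mathbb R^{d\times d}$ a covariance matrix with orthonormal eigenpairs $(\lambda_j,\omega_j)_{1\le j\le d}$, $\lambda^+_{\min}$ its smallest nonzero eigenvalue; $X^\star,X_0\in\mathbb R^d$; adversarial radius $\delta$; no explicit ridge penalty; constant learning rate $\gamma>0$. The deterministic limit of SGD is the ODE system for $\mathsf V_{j,11}$, $\mathsf V_{j,12}=\mathsf V_{j,21}$, with $\mathsf V_{j,22}\equiv\langle X^\star,\omega_j\rangle^2$, $\mathsf V_{j,11}(0)=\langle X_0,\omega_j\rangle^2$, $\mathsf V_{j,12}(0)=\langle X_0,\omega_j\rangle\langle X^\star,\omega_j\rangle$: $$\dot{\mathsf V}_{j,11}=-2\tilde\gamma^{\mathrm{eff}}(\lambda_j+\tilde\lambda^{\mathrm{eff}})\mathsf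 V_{j,11}+2\tilde\gamma^{\mathrm{eff}}\lambda_j\mathsf V_{j,12}+2\lambda_j\frac{\gamma^2}d\mathsf R^{\mathrm{Adv}},\qquad \dot{\mathsf V}_{j,12}=-\tilde\gamma^{\mathrm{eff}}(\lambda_j+\tilde\lambda^{\mathrm{eff}})\mathsf V_{j,12}+\tilde\gamma^{\mathrm{eff}}\lambda_j\mathsf V_{j,22},$$ where $$\mathsf R=\tfrac12\sum_j\lambda_j(\mathsf V_{j,11}-2\mathsf V_{j,12}+\mathsf V_{j,22})+\tfrac{\eta^2}2,\quad\widehat{\mathsf B}_{44}=\sum_j\mathsf V_{j,11},\quad \mathsf R^{\mathrm{Adv}}=\mathsf R+\delta\sqrt{\tfrac2\pi}\sqrt{2\widehat{\mathsf B}_{44}\mathsf R}+\tfrac{\delta^2}2\widehat{\mathsf B}_{44},$$ $q(t)=\sqrt{\widehat{\mathsf B}_{44}(t)/(2\mathsf R(t))}$, $\tilde\gamma^{\mathrm{eff}}(t)=\gamma(1+\delta\sqrt{2/\pi}\,q(t))$, $\tilde\lambda^{\mathrm{eff}}(t)=\tilde\lambda^{\mathrm{eff}}(q(t))$. The constant $r_\star\approx8.35\times10^{-5}$ is $r_\star=\sup_{s>0}\max(P(s)/Q(s),0)$ where, with $c=\sqrt{2/\pi}$, $$P(s)=(2-3c^2)s^4+(3c-7c^3)s^3-(4c^4+2c^2)s^2-(3c^3+c)s-c^2,$$ $$Q(s)=c^2s^6+(7c^3-c)s^5+(8c^4+8c^2-2)s^4+(15c^3+c)s^3+9c^2s^2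+2cs.$$
   Formalization: The formal F_∞ includes the extra noise term η²/2, used in the fixed point equation and in R(∞); as printed, without this term, the formulas fail whenever η≠0, since R contains η²/2; for η=0 the two versions coincide. *)

(* Defs.v *)
(* MathComp-Analysis, over an arbitrary realType. *)
From HB Require Import structures.
From mathcomp Require Import all_boot all_order all_algebra.
From mathcomp Require Import all_classical all_reals all_analysis.

Set Implicit Arguments.
Unset Strict Implicit.
Unset Printing Implicit Defensive.

Import Order.TTheory GRing.Theory Num.Theory.
Import numFieldNormedType.Exports.

Local Open Scope classical_set_scope.
Local Open Scope ring_scope.

Definition inner (R : realType) (d : nat) (u v : 'cV[R]_d) : R :=
  \sum_(i < d) u i 0 * v i 0.

(* A symmetric positive semidefinite matrix, possibly singular. *)
Definition covariance_matrix (R : realType) (d : nat) (K : 'M[R]_d) : Prop :=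
  K^T = K /\ forall x : 'cV[R]_d, 0 <= inner x (K *m x).

Definition orthonormal_eigenpairs (R : realType) (d : nat) (K : 'M[R]_d)
    (lam : 'I_d -> R) (omega : 'I_d -> 'cV[R]_d) : Prop :=
  (forall j, K *m omega j = lam j *: omega j) /\
  (forall i j, inner (omega i) (omega j) = (i == j)%:R).

(* The set is finite, so this infimum is a minimum as soon as some eigenvalue
   is nonzero. *)
Definition lambda_min_plus (R : realType) (d : nat) (lam : 'I_d -> R) : R :=
  inf [set lam j | j in [set j | lam j != 0]].

(* c = E|N(0,1)| *)
Definition cst (R : realType) : R := Num.sqrt (2 / pi).
Arguments cst {R}.

Definition numP (R : realType) (s : R) : R :=
  let c : R := cst in
  (2 - 3 * c ^+ 2) * s ^+ 4 + (3 * c - 7 * c ^+ 3) * s ^+ 3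
  - (4 * c ^+ 4 + 2 * c ^+ 2) * s ^+ 2 - (3 * c ^+ 3 + c) * s - c ^+ 2.

Definition denQ (R : realType) (s : R) : R :=
  let c : R := cst in
  c ^+ 2 * s ^+ 6 + (7 * c ^+ 3 - c) * s ^+ 5
  + (8 * c ^+ 4 + 8 * c ^+ 2 - 2) * s ^+ 4 + (15 * c ^+ 3 + c) * s ^+ 3
  + 9 * c ^+ 2 * s ^+ 2 + 2 * c * s.

(* About 8.345e-5, attained near s = 23.07. *)
Definition r_star (R : realType) : R :=
  sup [set Num.max (numP s / denQ s) 0 | s in [set s : R | 0 < s]].
Arguments r_star {R}.

(* [V11], [V12] are the unknown functions of time, indexed by the eigenmodes;
   the constant third one is V22 j = x_j ^+ 2, where x_j = <X_star, omega_j>. *)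

Definition Risk (R : realType) (d : nat) (eta : R) (lam x : 'I_d -> R)
    (V11 V12 : 'I_d -> R -> R) (t : R) : R :=
  2^-1 * (\sum_(j < d) lam j * (V11 j t - 2 * V12 j t + x j ^+ 2))
  + eta ^+ 2 / 2.

Definition B44 (R : realType) (d : nat) (V11 : 'I_d -> R -> R) (t : R) : R :=
  \sum_(j < d) V11 j t.

Definition RiskAdv (R : realType) (d : nat) (eta delta : R) (lam x : 'I_d -> R)
    (V11 V12 : 'I_d -> R -> R) (t : R) : R :=
  let r := Risk eta lam x V11 V12 t in
  let b := B44 V11 t in
  r + delta * cst * Num.sqrt (2 * b * r) + delta ^+ 2 / 2 * b.

Definition qratio (R : realType) (d : nat) (eta : R) (lam x : 'I_d -> R)
    (V11 V12 : 'I_d -> R -> R) (t : R) : R :=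
  Num.sqrt (B44 V11 t / (2 * Risk eta lam x V11 V12 t)).

Definition gamma_eff (R : realType) (gamma delta q : R) : R :=
  gamma * (1 + delta * cst * q).

Definition lambda_eff (R : realType) (delta q : R) : R :=
  (delta ^+ 2 + delta * cst * q^-1) / (1 + delta * cst * q).

(* The differential equations are required for t > 0, together with continuity
   on [0, +oo[, so that nothing is assumed about negative times. *)
Definition adv_ode (R : realType) (d : nat) (gamma eta delta : R)
    (lam x x0 : 'I_d -> R) (V11 V12 : 'I_d -> R -> R) : Prop :=
  let q := qratio eta lam x V11 V12 in
  let g t := gamma_eff gamma delta (q t) in
  let l t := lambda_eff delta (q t) in
  forall j : 'I_d,
  [/\ {within `[0, +oo[, continuous (V11 j)},
      {within `[0, +oo[, continuous (V12 j)},
      V11 j 0 = x0 j ^+ 2 /\ V12 j 0 = x0 j * x j,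
      forall t : R, 0 < t ->
        is_derive t 1 (V11 j)
          (- 2 * g t * (lam j + l t) * V11 j t + 2 * g t * lam j * V12 j t
           + 2 * lam j * (gamma ^+ 2 / d%:R)
             * RiskAdv eta delta lam x V11 V12 t)
    & forall t : R, 0 < t ->
        is_derive t 1 (V12 j)
          (- g t * (lam j + l t) * V12 j t + g t * lam j * x j ^+ 2)].

Definition Gfun (R : realType) (delta q : R) : R :=
  1 + 2 * delta * cst * q + delta ^+ 2 * q ^+ 2.

Definition Dfun (R : realType) (delta lamj q : R) : R :=
  lamj * (1 + delta * cst * q) + delta ^+ 2 + delta * cst * q^-1.

Definition CR (R : realType) (d : nat) (gamma delta : R) (lam : 'I_d -> R)
    (q : R) : R :=
  gamma / (2 * d%:R) * \sum_(j < d) lam j ^+ 2 / Dfun delta (lam j) q.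

Definition CB (R : realType) (d : nat) (gamma delta : R) (lam : 'I_d -> R)
    (q : R) : R :=
  gamma / d%:R * \sum_(j < d) lam j / Dfun delta (lam j) q.

(* The limit of the forcing term of [Risk].  The summand eta ^+ 2 / 2 is the
   noise floor contained in [Risk]: substituting the stationary values of V11
   and V12 for q constant gives Risk = Finf + G * CR * Risk with this summand.
   The bare sum is the noiseless case eta = 0. *)
Definition Finf (R : realType) (d : nat) (eta delta : R) (lam x : 'I_d -> R)
    (q : R) : R :=
  let l := lambda_eff delta q in
  2^-1 * (\sum_(j < d) lam j * (l / (lam j + l)) ^+ 2 * x j ^+ 2)
  + eta ^+ 2 / 2.

Definition Linf (R : realType) (d : nat) (delta : R) (lam x : 'I_d -> R)
    (q : R) : R :=
  let l := lambda_eff delta q in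
  \sum_(j < d) (lam j / (lam j + l)) ^+ 2 * x j ^+ 2.

Definition fixed_point (R : realType) (d : nat) (gamma eta delta : R)
    (lam x : 'I_d -> R) (q : R) : Prop :=
  q ^+ 2 =
    (1 - Gfun delta q * CR gamma delta lam q)
      * (Linf delta lam x q / (2 * Finf eta delta lam x q))
    + 2^-1 * Gfun delta q * CB gamma delta lam q.

Definition admissible (R : realType) (d : nat) (gamma delta : R)
    (lam : 'I_d -> R) (q : R) : Prop :=
  Gfun delta q * CR gamma delta lam q < 1.

(* Main.v *)
(** Stationary limit.  While [R, B44 > 0] one has [RAdv >= 0], hence the
    Cauchy-Schwarz type invariant [V12^2 <= x^2 V11]; at a first zero of
    [min R B44] the equations then force a strictly positive derivative, so
    [R] and [B44] stay positive.  Now [RAdv = G(q) R], and every mode solves a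
    scalar equation [y' = - a y + b], whose solution is asymptotically between
    the extreme values of [b / a].  Consequently, an eventual bound [R <= r]
    improves to [R <= Finf + kappa r + e] for every [e > 0], with
    [kappa = G CR] at [qinf], and likewise for lower bounds.  As [Finf > 0] and
    [R] is bounded, this forces [kappa < 1] and [R --> Finf / (1 - kappa)].

    Uniqueness.  Divided by [q^2], the right-hand side of the fixed point
    equation is [(1 - G CR) A + G CB / (2 q^2)] with [A = Linf / (2 q^2 Finf)].
    In [q], [G CR] is strictly increasing while [A] and [G CB / q^2] are
    nonincreasing, so the value 1 is taken at most once where [G CR < 1]. *)
Require Import Defs.
From HB Require Import structures.
From mathcomp Require Import all_boot all_order all_algebra.
From mathcomp Require Import all_classical all_reals all_analysis.
From mathcomp Require Import ring lra.
Import Order.TTheory GRing.Theory Num.Theory.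
Import numFieldNormedType.Exports.
Local Open Scope classical_set_scope.
Local Open Scope ring_scope.
Local Notation cst := Defs.cst.

Set Implicit Arguments.
Unset Strict Implicit.
Unset Printing Implicit Defensive.

(** * Scalar differential inequalities *)

(** The zeros of [f] in the segment form a compact set. [T] is its minimum: a nonpositive value
    before [T] would give an earlier zero by the intermediate value theorem. *)
Lemma segment_first_zero (R : realType) (f : R -> R) (a b : R) :
  a <= b -> {within `[a, b], continuous f} -> 0 < f a -> f b <= 0 ->
  exists T, [/\ a < T, T <= b, f T = 0 & forall t, a <= t -> t < T -> 0 < f t].
Proof.
move=> ab cf fa fb.
pose Z := f @^-1` [set 0].
have cZ : compact (`[a, b] `&` Z).
  have /closed_subspaceP[V cV VZ] : closed (Z : set (subspace `[a, b])).
    by move/continuous_closedP : cf; apply; exact: closed_eq.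
  rewrite setIC -VZ setIC.
  exact: compact_closedI (@segment_compact _ _ _) cV.
have ivt c : a <= c -> c <= b -> f c <= 0 -> exists2 t, a <= t <= c & f t = 0.
  move=> ac cb fc; have [||t] := @IVT _ f a c 0 ac.
  - by apply: continuous_subspaceW cf; apply: subset_itvl; rewrite bnd_simp.
  - by rewrite ge_min fc orbT le_max (ltW fa).
  by rewrite in_itv/= => tac ft; exists t.
have Z0 : (`[a, b] `&` Z) !=set0.
  by have [t tab ft] := ivt b ab (lexx _) fb; exists t; split => //=;
    rewrite in_itv.
have cid : {within `[a, b] `&` Z, continuous (fun t : R => t)}.
  by apply: continuous_subspaceT => t; exact: cvg_id.
have [T] := compact_EVT_min Z0 cZ cid.
rewrite inE => -[/=]; rewrite in_itv/= => /andP[aT Tb] fT minT.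
exists T; split => //.
  rewrite lt_neqAle aT andbT; apply: contraTneq fa => ->; by rewrite fT ltxx.
move=> t at_ tT; rewrite ltNge; apply/negP => ft.
have [s /andP[as_ st] fs] := ivt t at_ (ltW (lt_le_trans tT Tb)) ft.
have := minT s; rewrite inE => /(_ _)/=.
rewrite leNgt (le_lt_trans st tT) => H; apply: (notF (H _)).
by split => //=; rewrite in_itv/= as_ (le_trans st)// (le_trans (ltW tT)).
Qed.

(** Time reversal of the previous lemma, applied to [- f (- t)]. *)
Lemma segment_last_zero (R : realType) (f : R -> R) (a b : R) :
  a <= b -> {within `[a, b], continuous f} -> 0 <= f a -> f b < 0 ->
  exists s, [/\ a <= s, s < b, f s = 0 & forall t, s < t -> t <= b -> f t < 0].
Proof.
move=> ab cf fa fb.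
have cg : {within `[- b, - a], continuous (fun t => - f (- t))}.
  move=> t; apply: continuousN.
  have := @within_continuous_compN R R R f (- b) (- a); rewrite !opprK; exact.
have [|||s [bs sa fs fpos]] := @segment_first_zero R (fun t =>
  - f (- t)) (- b) (- a) _ cg.
- by rewrite lerN2.
- by rewrite opprK oppr_gt0.
- by rewrite opprK oppr_le0.
exists (- s); split.
- by rewrite lerNr.
- by rewrite ltrNl.
- by apply/eqP; rewrite -oppr_eq0 fs.
move=> t st tb; rewrite -oppr_gt0 -[t]opprK; apply: fpos; first by rewrite lerN2.
by rewrite ltrNl.
Qed.

(** The sign of the derivative is asked for only where [f] is negative: after its last zero such an
    [f] cannot decrease, by the mean value theorem. *)
Lemma barrier_ge0 (R : realType) (f f' : R -> R) (a b : R) :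
  a <= b -> {within `[a, b], continuous f} ->
  (forall t, a < t -> t < b -> is_derive t 1 f (f' t)) ->
  (forall t, a < t -> t < b -> f t < 0 -> 0 <= f' t) ->
  0 <= f a -> 0 <= f b.
Proof.
move=> ab cf df f'0 fa; rewrite leNgt; apply/negP => fb.
have [s [as_ sb fs fneg]] := segment_last_zero ab cf fa fb.
have [||c] := @MVT _ f f' s b sb.
- by move=> t; rewrite in_itv/= => /andP[st tb]; apply: df;
    rewrite ?(le_lt_trans as_).
- apply: continuous_subspaceW cf; apply: subset_itvr; by rewrite bnd_simp.
rewrite in_itv/= => /andP[sc cb]; rewrite fs subr0 => fbE.
move: fb; rewrite fbE ltNge mulr_ge0//; last by rewrite subr_ge0 ltW.
by apply: f'0; rewrite ?(le_lt_trans as_)// fneg// ltW.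
Qed.

(** The left difference quotients at [T] are negative. A strictly positive derivative therefore
    excludes a first zero. *)
Lemma is_derive_left_zero_le0 (R : realType) (f : R -> R) (a T df : R) :
  a < T -> is_derive T 1 f df -> f T = 0 ->
  (forall t, a <= t -> t < T -> 0 < f t) -> df <= 0.
Proof.
move=> aT [dfT <-] fT fpos.
rewrite ['D_1 f T]cvg_at_leftE; last exact: dfT.
apply: limr_le.
  rewrite -(cvg_at_leftE (fun h => h^-1 *: ((f \o shift T) _ - f T))) //.
  apply: cvg_trans dfT; apply: cvg_app.
  by move=> A [e egt0 Ae]; exists e => // x xe xgt0; apply: Ae => //;
    exact/ltr0_neq0.
near=> h; have h0 : h < 0 by near: h; exists 1 => /=.
apply: mulr_le0_ge0; first by rewrite invr_le0 ltW.
rewrite fT subr0 [_%:A]mulr1 /= ltW//; apply: fpos; last by rewrite gtrDr.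
near: h; exists (T - a); first by rewrite /= subr_gt0.
by move=> h; rewrite /= distrC subr0 => /ltr_normlP [? _] _; lra.
Unshelve. all: by end_near. Qed.

(** Past some time [t1], [y] stays below the barrier [m + e / 2 + M * expR (- alpha * (t - t1))],
    whose last term dies out. The forcing [b] is only bounded above, so the lemma also applies when
    [b] is not known to converge. *)
Lemma eventually_le_of_relaxation (R : realType) (y a b h : R -> R) (alpha m e
  : R) :
  0 < alpha -> 0 < e ->
  (forall t : R, 0 < t -> is_derive t 1 y (- a t * y t + b t)) ->
  (\forall t \near +oo, alpha <= a t) ->
  (\forall t \near +oo, b t <= h t * a t) ->
  h t @[t --> +oo] --> m ->
  \forall t \near +oo, y t <= m + e.
Proof.
move=> al0 e0 dy aT bT hm.
have e20 : 0 < e / 2 by rewrite divr_gt0.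
have hm' : \forall t \near +oo, h t <= m + e / 2.
  near do apply: ltW.
  by move: hm => /cvgr_lt; apply; rewrite ltrDl.
have [t1 t1_gt0 /=] : exists2 t1 : R, 0 < t1 & forall t : R, t1 < t ->
    [/\ alpha <= a t, b t <= h t * a t & h t <= m + e / 2].
  have [M [Mr HM]] : \forall t \near +oo,
      [/\ alpha <= a t, b t <= h t * a t & h t <= m + e / 2].
    by near=> t; split; near: t.
  exists (Num.max M 1); first by rewrite lt_max ltr01 orbT.
  by move=> t; rewrite gt_max => /andP[/HM].
move=> Ht1.
pose M := Num.max 0 (y t1 - (m + e / 2)).
have M0 : 0 <= M by rewrite le_max lexx.
pose f (t : R) : R := m + e / 2 + M * expR (- alpha * (t - t1)) - y t.
pose f' (t : R) : R := - alpha * M * expR (- alpha * (t - t1)) + a t * y t - b t.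
have df (t : R) : 0 < t -> is_derive t 1 f (f' t).
  move=> t0; have dyt := dy t t0.
  have dE : is_derive t 1 (fun t : R => expR (- alpha * (t - t1)))
     (expR (- alpha * (t - t1)) * - alpha).
    apply: is_derive1_comp.
    apply: is_derive_eq; rewrite /GRing.scale/=; ring.
  apply: is_derive_eq; rewrite /GRing.scale/= /f'; ring.
have fpos t : t1 <= t -> 0 <= f t.
  move=> t1t; apply: (@barrier_ge0 _ f f' t1 t t1t).
  - apply: derivable_within_continuous => s; rewrite in_itv/= => /andP[ts _].
    by have [] := df s (lt_le_trans t1_gt0 ts).
  - by move=> s ts _; exact: df s (lt_trans t1_gt0 ts).
  (* Above the barrier, [y - (m + e / 2)] exceeds [M * E] and [a] is at least [alpha], so [y] falls
     at least as fast as the barrier. *)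
  - move=> s ts _; rewrite /f subr_lt0 => ys.
    have [as_ bs hs] := Ht1 s ts.
    set E := expR _ in ys *; have E0 : 0 <= M * E by rewrite mulr_ge0 ?expR_ge0.
    rewrite /f' -/E.
    have as0 : 0 < a s by apply: lt_le_trans as_.
    have b1 : b s <= (m + e / 2) * a s by apply: (le_trans bs); rewrite ler_pM2r.
    have : alpha * (M * E) <= a s * (y s - (m + e / 2)).
      apply: ler_pM => //; first exact: ltW.
      by rewrite lerBrDl ltW.
    by lra.
  - have : y t1 - (m + e / 2) <= M by rewrite le_max lexx orbT.
    by rewrite /f subrr mulr0 expR0; lra.
have E_cvg : M * expR (- alpha * (t - t1)) @[t --> +oo] --> 0.
  rewrite -(mulr0 M); apply: cvgMr.
  have : expR (- (alpha * (t - t1))) @[t --> +oo] --> 0.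
    apply: (@cvg_comp _ _ _ (fun t => alpha * (t - t1)) (fun x =>
      expR (- x)) _ +oo); last exact: cvgr_expR.
    apply: gt0_cvgMry => //; exact: cvg_addrr.
  by under eq_fun do rewrite -mulNr.
have E_lt : \forall t \near +oo, M * expR (- alpha * (t - t1)) < e / 2.
  by move: E_cvg => /cvgr_lt; apply.
near=> t.
have : 0 <= f t.
  by apply: fpos; near: t; apply: nbhs_pinfty_ge; rewrite num_real.
have : M * expR (- alpha * (t - t1)) < e / 2 by near: t.
by rewrite /f; lra.
Unshelve. all: by end_near. Qed.

Lemma relaxation_cvg (R : realType) (y a b h : R -> R) (alpha m : R) :
  0 < alpha ->
  (forall t : R, 0 < t -> is_derive t 1 y (- a t * y t + b t)) ->
  (\forall t \near +oo, alpha <= a t) ->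
  (\forall t \near +oo, b t = h t * a t) ->
  h t @[t --> +oo] --> m -> y t @[t --> +oo] --> m.
Proof.
move=> al0 dy aT bT hm; apply/cvgrPdist_le => e e0.
have up : \forall t \near +oo, y t <= m + e.
  apply: (eventually_le_of_relaxation al0 e0 dy aT _ hm).
  by near=> t; rewrite le_eqVlt; apply/orP; left; apply/eqP; near: t.
have lo : \forall t \near +oo, - y t <= - m + e.
  apply: (@eventually_le_of_relaxation _ (fun t => - y t) a
    (fun t => - b t) (fun t => - h t) alpha _ _ al0 e0).
  - move=> t t0; have := dy t t0 => D.
    by apply: is_derive_eq; rewrite /GRing.scale/=; ring.
  - exact: aT.
  - by near=> t; rewrite mulNr lerN2 le_eqVlt; apply/orP; left; rewrite eq_sym;
      apply/eqP; near: t.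
  - exact: cvgN.
near=> t; rewrite ler_distlC; apply/andP; split.
  by rewrite -lerN2 opprB addrC; near: t.
by near: t.
Unshelve. all: by end_near. Qed.

(** [sup L] and [inf U] are the lower and upper limits of [f]. Each inherits an affine inequality;
    the lower one with [F > 0] forces [k < 1], and then both limits are squeezed onto the fixed
    point of the map sending [r] to [F + k * r]. *)
Lemma cvg_of_affine_bounds (R : realType) (f : R -> R) (F k M : R) :
  0 < F -> 0 <= k ->
  (\forall t \near +oo, 0 <= f t) -> (\forall t \near +oo, f t <= M) ->
  (forall r e, 0 < e -> (\forall t \near +oo, f t <= r) ->
    \forall t \near +oo, f t <= F + k * r + e) ->
  (forall r e, 0 < e -> (\forall t \near +oo, r <= f t) ->
    \forall t \near +oo, F + k * r - e <= f t) ->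
  k < 1 /\ f t @[t --> +oo] --> F / (1 - k).
Proof.
move=> F0 k0 f0 fM up low.
pose U := [set r | \forall t \near +oo, f t <= r].
pose L := [set r | \forall t \near +oo, r <= f t].
have LU r s : L r -> U s -> r <= s.
  move=> Lr Us; suff : \forall t \near (+oo : set_system R), r <= s.
    by move=> /filter_ex[].
  near=> t; apply: (@le_trans _ _ (f t)); by near: t.
have supL : has_sup L by split; [exists 0|exists M => r Lr; exact: LU fM].
have infU : has_inf U by split; [exists M|exists 0 => r Ur; exact: LU Ur].
have lo0 : 0 <= sup L by apply: sup_ubound f0; have [] := supL.
have loE : F + k * sup L <= sup L.
  rewrite leNgt; apply/negP => lt.
  (* An [r] within [e] of [sup L] and the slack [e] of the hypothesis cost at most [(k + 1) * e],
     less than the gap [(k + 2) * e]. *)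
  pose e := (F + k * sup L - sup L) / (k + 2).
  have e0 : 0 < e by rewrite divr_gt0 ?subr_gt0// ltr_wpDl.
  have [r Lr ler] := sup_adherent e0 supL.
  have : F + k * r - e <= sup L by apply: sup_ubound (low _ _ e0 Lr);
    have [] := supL.
  have : k * (sup L - e) <= k * r by rewrite ler_wpM2l// ltW.
  have : (k + 2) * e = F + k * sup L - sup L.
    by rewrite mulrC divfK// gt_eqF// ltr_wpDl.
  by lra.
have k1 : k < 1.
  rewrite ltNge; apply/negP => k1.
  have : sup L <= k * sup L by rewrite ler_peMl.
  by lra.
have k1' : 0 < 1 - k by rewrite subr_gt0.
have loF : F / (1 - k) <= sup L by rewrite ler_pdivrMr//; lra.
have hiE : inf U <= F + k * inf U.
  rewrite leNgt; apply/negP => lt.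
  pose e := (inf U - (F + k * inf U)) / (k + 2).
  have e0 : 0 < e by rewrite divr_gt0 ?subr_gt0// ltr_wpDl.
  have [r Ur ler] := inf_adherent e0 infU.
  have : inf U <= F + k * r + e by apply: inf_lbound (up _ _ e0 Ur);
    have [] := infU.
  have : k * r <= k * (inf U + e) by rewrite ler_wpM2l// ltW.
  have : (k + 2) * e = inf U - (F + k * inf U).
    by rewrite mulrC divfK// gt_eqF// ltr_wpDl.
  by lra.
have hiF : inf U <= F / (1 - k) by rewrite ler_pdivlMr//; lra.
split => //; apply/cvgrPdist_le => e e0.
have [r Lr ler] := sup_adherent e0 supL.
have [s Us les] := inf_adherent e0 infU.
near=> t; rewrite ler_distlC; apply/andP; split.
  by apply: (@le_trans _ _ r); [lra|near: t].
by apply: (@le_trans _ _ s); [near: t|lra].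
Unshelve. all: by end_near. Qed.

(** * Uniqueness of the fixed point *)

Lemma sumr_gt0 (R : realType) (d : nat) (f : 'I_d -> R) :
  (forall j, 0 <= f j) -> (exists j, 0 < f j) -> 0 < \sum_(j < d) f j.
Proof.
move=> f0 [j fj]; rewrite (bigD1 j)//=.
by apply: ltr_pwDl => //; apply: sumr_ge0.
Qed.

Lemma ord_natr_gt0 (R : realType) (d : nat) (j : 'I_d) : 0 < d%:R :> R.
Proof. by rewrite ltr0n (leq_ltn_trans _ (ltn_ord j)). Qed.

Lemma cst_gt0 (R : realType) : 0 < cst :> R.
Proof. by rewrite sqrtr_gt0 divr_gt0 ?pi_gt0. Qed.

Lemma cst_le1 (R : realType) : cst <= 1 :> R.
Proof. by rewrite -[leRHS]sqrtr1 ler_sqrt// ler_pdivrMr ?pi_gt0// mul1r pi_ge2.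
  Qed.

(** * Monotonicity in [q] of the elementary quantities *)

Section monotonicity.
Variables (R : realType) (delta p q : R).
Hypotheses (delta_gt0 : 0 < delta) (p_gt0 : 0 < p) (pq : p < q).
Let c : R := cst.
Let c_gt0 : 0 < c. Proof. exact: cst_gt0. Qed.

Lemma den_gt0 (s : R) : 0 < s -> 0 < 1 + delta * cst * s.
Proof. by move=> s0; rewrite addr_gt0// !mulr_gt0 ?cst_gt0. Qed.

Lemma Gfun_gt0 (s : R) : 0 < s -> 0 < Gfun delta s.
Proof.
by move=> s0; rewrite /Gfun !addr_gt0// !mulr_gt0 ?exprn_gt0 ?cst_gt0.
Qed.

Lemma lambda_eff_gt0 (s : R) : 0 < s -> 0 < lambda_eff delta s.
Proof.
move=> s0; rewrite divr_gt0 ?den_gt0// addr_gt0 ?exprn_gt0// !mulr_gt0 ?cst_gt0//.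
by rewrite invr_gt0.
Qed.

Lemma DfunE (lamj s : R) : 0 < s ->
  Dfun delta lamj s = (1 + delta * cst * s) * (lamj + lambda_eff delta s).
Proof.
move=> s0; rewrite /Dfun /lambda_eff; field.
by rewrite !gt_eqF ?den_gt0.
Qed.

Lemma Dfun_gt0 (lamj s : R) : 0 <= lamj -> 0 < s -> 0 < Dfun delta lamj s.
Proof.
move=> l0 s0; rewrite DfunE// mulr_gt0 ?den_gt0//.
by rewrite ltr_wpDl// lambda_eff_gt0.
Qed.

Lemma lambda_effM (s : R) : 0 < s ->
  s * lambda_eff delta s = (delta ^+ 2 * s + delta * cst) / (1 + delta * cst * s).
Proof. by move=> s0; rewrite /lambda_eff; field; rewrite !gt_eqF ?den_gt0. Qed.

Let q_gt0 : 0 < q. Proof. exact: lt_trans pq. Qed.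

Lemma lambda_eff_decr : lambda_eff delta q < lambda_eff delta p.
Proof.
rewrite /lambda_eff ltr_pdivrMr ?den_gt0// [ltRHS]mulrAC ltr_pdivlMr ?den_gt0//.
have : q^-1 < p^-1 by rewrite ltf_pV2.
have : 0 < q^-1 by rewrite invr_gt0.
rewrite -/c; move: (q^-1) (p^-1) => q' p' q'0 qp'.
have dc : 0 < delta * c by rewrite mulr_gt0.
apply: ltr_pM; rewrite ?addr_ge0 ?sqr_ge0 ?mulr_ge0 ?ltW// ?ltrD2l ?ltr_pM2l//.
Qed.

(** After cross-multiplication the difference is [delta ^+ 2 * (1 - c * c) * (q - p)], nonnegative
    because [cst] is at most 1. *)
Lemma lambda_effM_incr : p * lambda_eff delta p <= q * lambda_eff delta q.
Proof.
rewrite !lambda_effM// ler_pdivrMr ?den_gt0// [leRHS]mulrAC ler_pdivlMr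
  ?den_gt0//.
rewrite -subr_ge0 -/c [leRHS](_ : _ = delta ^+ 2 * (1 - c * c) * (q - p));
  last by ring.
rewrite mulr_ge0 ?subr_ge0 ?(ltW pq)// mulr_ge0 ?sqr_ge0// subr_ge0.
by rewrite mulr_ile1 ?cst_le1// ltW.
Qed.

Lemma Gfun_den_incr :
  Gfun delta p / (1 + delta * c * p) < Gfun delta q / (1 + delta * c * q).
Proof.
rewrite /Gfun ltr_pdivrMr ?den_gt0// [ltRHS]mulrAC ltr_pdivlMr ?den_gt0//.
rewrite -subr_gt0 -/c [ltRHS](_ : _ =
  (q - p) * (delta * c + delta ^+ 2 * (p + q) + delta ^+ 3 * c * p * q));
    last by ring.
by rewrite mulr_gt0 ?subr_gt0// !addr_gt0// !mulr_gt0 ?exprn_gt0// addr_gt0.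
Qed.

(** [DfunE] splits the quotient into two increasing positive factors, [Gfun] over
    [1 + delta * c * q] and the inverse of [lamj + lambda_eff]. *)
Lemma Gfun_Dfun_incr (lamj : R) : 0 <= lamj ->
  Gfun delta p / Dfun delta lamj p < Gfun delta q / Dfun delta lamj q.
Proof.
move=> l0; rewrite !DfunE// !invfM !mulrA.
have lq := lambda_eff_gt0 q_gt0; have lpq := lambda_eff_decr.
apply: ltr_pM.
- by apply: mulr_ge0; rewrite ?invr_ge0 ltW ?Gfun_gt0 ?den_gt0.
- by rewrite invr_ge0 ltW// ltr_wpDl// lambda_eff_gt0.
- exact: Gfun_den_incr.
- by rewrite ltf_pV2 ?ltrD2l ?posrE ?(ltr_wpDl l0)// lambda_eff_gt0.
Qed.

(** Division-free monotonicity of [Gfun / (q ^+ 2 * Dfun)]. Multiplying [Dfun] by its argument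
    removes the inverse; the difference is then [q - p] times a polynomial with nonnegative
    terms. *)
Lemma Gfun_sqr_Dfun_decr (lamj : R) : 0 <= lamj ->
  p ^+ 2 * (Gfun delta q / Dfun delta lamj q) <=
  q ^+ 2 * (Gfun delta p / Dfun delta lamj p).
Proof.
move=> l0; rewrite !mulrA ler_pdivrMr ?Dfun_gt0// [leRHS]mulrAC ler_pdivlMr
  ?Dfun_gt0//.
have key s : 0 < s -> s * Dfun delta lamj s =
    lamj * (s * (1 + delta * c * s)) + delta * (delta * s + c).
  by move=> s0; rewrite /Dfun -/c; field; rewrite gt_eqF.
have -> : p ^+ 2 * Gfun delta q * Dfun delta lamj p
  = p * (Gfun delta q * (p * Dfun delta lamj p)) by ring.
have -> : q ^+ 2 * Gfun delta p * Dfun delta lamj q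
  = q * (Gfun delta p * (q * Dfun delta lamj q)) by ring.
rewrite !key// /Gfun -/c -subr_ge0 [leRHS](_ : _ = (q - p) *
  (lamj * ((p + q) + 2 * delta * c * p * q + delta * c * (p ^+ 2 + p * q + q ^+ 2)
       + 2 * (delta * c) ^+ 2 * p * q * (p + q)
       + delta ^+ 3 * c * p ^+ 2 * q ^+ 2)
  + delta * (delta * (p + q) + c + delta ^+ 2 * c * p * q))); last by ring.
rewrite mulr_ge0 ?subr_ge0 ?(ltW pq)//.
by rewrite !(addr_ge0, mulr_ge0, exprn_ge0)// ltW.
Qed.

End monotonicity.

(** For [u < v] the ratio [(z + v) / (z + u)] decreases in [z]. Replacing its value at [x] by that
    at the pivot [a] lowers it where [x - a] is negative and raises it where [x - a] is positive;
    the product grows either way. *)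
Lemma ratio_pivot (R : realType) (u v x a : R) :
  0 < u -> u < v -> 0 <= x -> 0 <= a ->
  (x - a) * ((x + v) / (x + u)) ^+ 2 <= (x - a) * ((a + v) / (a + u)) ^+ 2.
Proof.
move=> u0 uv x0 a0.
have v0 : 0 < v by exact: lt_trans uv.
have mono y z : 0 <= y -> y <= z ->
    ((z + v) / (z + u)) ^+ 2 <= ((y + v) / (y + u)) ^+ 2.
  move=> y0 yz; have z0 := le_trans y0 yz.
  rewrite ler_pXn2r ?nnegrE ?divr_ge0 ?addr_ge0 ?(ltW u0) ?(ltW v0)//.
  rewrite ler_pdivrMr ?ltr_wpDl// [leRHS]mulrAC ler_pdivlMr ?ltr_wpDl//.
  rewrite -subr_ge0 [leRHS](_ : _ = (z - y) * (v - u)); last by ring.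
  by rewrite mulr_ge0 ?subr_ge0 ?(ltW uv).
case: (leP x a) => xa.
  by rewrite ler_wnM2l ?subr_le0// mono.
by rewrite ler_wpM2l ?subr_ge0 ?(ltW xa)// mono// ltW.
Qed.

(** * Comparison of two fixed points [p < q] *)

Section uniqueness.
Variables (R : realType) (d : nat) (gamma eta delta p q : R) (lam x : 'I_d -> R).
Hypotheses (gamma_gt0 : 0 < gamma) (delta_gt0 : 0 < delta).
Hypothesis lam_ge0 : forall j, 0 <= lam j.
Hypothesis signal : exists j, 0 < lam j * x j ^+ 2.
Hypotheses (p_gt0 : 0 < p) (pq : p < q).
Let q_gt0 : 0 < q. Proof. exact: lt_trans pq. Qed.

(** Moments of [lam] for the weights [x ^+ 2 / (lam + l) ^+ 2]: [Linf] is the second one, and the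
    noiseless part of [2 * Finf] is [l ^+ 2] times the first. *)
Let S (n : nat) (l : R) := \sum_(j < d) lam j ^+ n * x j ^+ 2 / (lam j + l) ^+ 2.

Let S_gt0 n l : 0 < l -> 0 < S n.+1 l.
Proof.
move=> l0; apply: sumr_gt0 => [j|].
  by rewrite !(sqr_ge0, divr_ge0, mulr_ge0, exprn_ge0).
have [j lx] := signal; exists j.
have lj : 0 < lam j.
  by rewrite lt_neqAle lam_ge0 andbT; apply: contraTneq lx => <-;
    rewrite mul0r ltxx.
have x2 : 0 < x j ^+ 2 by move: lx; rewrite pmulr_rgt0.
by rewrite divr_gt0 ?(mulr_gt0 _ x2)// exprn_gt0 ?addr_gt0.
Qed.

Lemma LinfE s : Linf delta lam x s = S 2 (lambda_eff delta s).
Proof. by apply: eq_bigr => j _; rewrite expr_div_n mulrAC. Qed.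

Lemma FinfE s : 2 * Finf eta delta lam x s =
  lambda_eff delta s ^+ 2 * S 1 (lambda_eff delta s) + eta ^+ 2.
Proof.
rewrite /Finf; set T := \sum_(j < d) _.
rewrite [LHS](_ : _ = T + eta ^+ 2); last by field.
congr (_ + _); rewrite big_distrr/=; apply: eq_bigr => j _.
by rewrite expr_div_n expr1; ring.
Qed.

Lemma Finf_gt0 s : 0 < s -> 0 < Finf eta delta lam x s.
Proof.
move=> s0; rewrite -(pmulr_rgt0 _ (ltr0n _ 2)) FinfE.
by rewrite ltr_pwDl ?sqr_ge0// mulr_gt0 ?exprn_gt0 ?S_gt0 ?lambda_eff_gt0.
Qed.

Let lp := lambda_eff delta p.
Let lq := lambda_eff delta q.
Let lp0 : 0 < lp. Proof. exact: lambda_eff_gt0. Qed.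
Let lq0 : 0 < lq. Proof. exact: lambda_eff_gt0. Qed.
Let lpq : lq < lp. Proof. exact: lambda_eff_decr. Qed.

(* Lowering [l] shifts the weights [lam x^2 / (lam + l)^2] towards small [lam],
   so the weighted mean of [lam] decreases. *)
Let weighted_mean_decr : S 2 lq * S 1 lp <= S 2 lp * S 1 lq.
Proof.
have S1 := S_gt0 0 lp0; have S2 := S_gt0 1 lp0.
(* The pivot is the weighted mean at [lp], so the moment centred at [a] vanishes there;
   [ratio_pivot] passes from the weights at [lp] to those at [lq] up to the constant factor [k]. *)
pose a := S 2 lp / S 1 lp.
have a0 : 0 <= a by rewrite divr_ge0 ?ltW.
pose k := ((a + lp) / (a + lq)) ^+ 2.
have moment l : S 2 l - a * S 1 l =
    \sum_(j < d) (lam j - a) * (lam j * x j ^+ 2 / (lam j + l) ^+ 2).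
  by rewrite big_distrr -sumrB; apply: eq_bigr => j _ /=; ring.
have : S 2 lq - a * S 1 lq <= k * (S 2 lp - a * S 1 lp).
  rewrite !moment big_distrr; apply: ler_sum => j _ /=.
  have := ratio_pivot lq0 lpq (lam_ge0 j) a0; rewrite -/k => piv.
  have w0 : 0 <= lam j * x j ^+ 2 / (lam j + lp) ^+ 2.
    by rewrite !(sqr_ge0, divr_ge0, mulr_ge0).
  have := ler_wpM2r w0 piv; congr (_ <= _); last by ring.
  by field; rewrite !gt_eqF ?ltr_wpDl.
rewrite [a * S 1 lp]divfK ?gt_eqF// subrr mulr0 subr_le0 /a mulrAC.
by rewrite ler_pdivlMr.
Qed.

(** [2 * Finf] splits into a signal part, handled by [lambda_effM_incr] and the weighted mean, and
    the noise [eta ^+ 2], handled term by term through [p * (lam j + lp) <= q * (lam j + lq)]. *)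
Let signal_ratio_decr :
  p ^+ 2 * (Linf delta lam x q / (2 * Finf eta delta lam x q)) <=
  q ^+ 2 * (Linf delta lam x p / (2 * Finf eta delta lam x p)).
Proof.
have F2 s : 0 < s -> 0 < 2 * Finf eta delta lam x s.
  by move=> s0; rewrite mulr_gt0 ?Finf_gt0.
rewrite !mulrA ler_pdivrMr ?F2// [leRHS]mulrAC ler_pdivlMr ?F2//.
have lM : p * lp <= q * lq by exact: lambda_effM_incr.
rewrite !LinfE !FinfE -/lp -/lq !mulrDr; apply: lerD.
  have -> : p ^+ 2 * S 2 lq * (lp ^+ 2 * S 1 lp)
    = (p * lp) ^+ 2 * (S 2 lq * S 1 lp) by ring.
  have -> : q ^+ 2 * S 2 lp * (lq ^+ 2 * S 1 lq)
    = (q * lq) ^+ 2 * (S 2 lp * S 1 lq) by ring.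
  apply: ler_pM weighted_mean_decr; rewrite ?sqr_ge0//.
    by rewrite mulr_ge0 ?(ltW (S_gt0 _ _)).
  by apply: lerXn2r => //; rewrite nnegrE mulr_ge0 ?(ltW p_gt0) ?(ltW q_gt0)
    ?(ltW lp0) ?(ltW lq0).
apply: ler_wpM2r; first exact: sqr_ge0.
rewrite !big_distrr; apply: ler_sum => j _ /=; rewrite !mulrA.
rewrite ler_pdivrMr ?exprn_gt0 ?ltr_wpDl// [leRHS]mulrAC ler_pdivlMr ?exprn_gt0
  ?ltr_wpDl//.
rewrite [leLHS](_ : _ = (lam j * x j) ^+ 2 * (p * (lam j + lp)) ^+ 2);
  last by ring.
rewrite [leRHS](_ : _ = (lam j * x j) ^+ 2 * (q * (lam j + lq)) ^+ 2);
  last by ring.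
apply: ler_wpM2l; first exact: sqr_ge0.
apply: lerXn2r; rewrite ?nnegrE ?mulr_ge0 ?addr_ge0 ?(ltW p_gt0) ?(ltW q_gt0)
  ?(ltW lp0) ?(ltW lq0)//.
by rewrite !mulrDr lerD// ler_wpM2r// ltW.
Qed.

Let dgt0 : 0 < d%:R :> R.
Proof. by have [j _] := signal; exact: ord_natr_gt0 j. Qed.

(** Strict because the mode carrying signal has a positive eigenvalue. *)
Let GCR_incr :
  Gfun delta p * CR gamma delta lam p < Gfun delta q * CR gamma delta lam q.
Proof.
rewrite /CR !(mulrCA (Gfun _ _)) ltr_pM2l; last by rewrite divr_gt0 ?mulr_gt0.
rewrite !big_distrr -subr_gt0 -sumrB/=.
have E j : Gfun delta q * (lam j ^+ 2 / Dfun delta (lam j) q)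
    - Gfun delta p * (lam j ^+ 2 / Dfun delta (lam j) p)
  = lam j ^+ 2 * (Gfun delta q / Dfun delta (lam j) q
                  - Gfun delta p / Dfun delta (lam j) p) by ring.
apply: sumr_gt0 => [j|].
  by rewrite E mulr_ge0 ?sqr_ge0// subr_ge0 ltW// Gfun_Dfun_incr.
have [j lx] := signal; exists j; rewrite E mulr_gt0 ?subr_gt0 ?Gfun_Dfun_incr//.
by rewrite lt_neqAle sqr_ge0 andbT eq_sym sqrf_eq0; apply: contraTneq lx => ->;
  rewrite mul0r ltxx.
Qed.

Let GCB_decr : p ^+ 2 * (Gfun delta q * CB gamma delta lam q) <=
  q ^+ 2 * (Gfun delta p * CB gamma delta lam p).
Proof.
rewrite /CB !(mulrCA (Gfun _ _)) !(mulrCA (_ ^+ 2)) ler_pM2l ?divr_gt0//.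
rewrite !big_distrr; apply: ler_sum => j _ /=.
have := ler_wpM2l (lam_ge0 j) (Gfun_sqr_Dfun_decr delta_gt0 p_gt0 pq (lam_ge0 j)).
by congr (_ <= _); ring.
Qed.

(** The equation at [p] times [q ^+ 2] and the equation at [q] times [p ^+ 2] express the same
    number [p ^+ 2 * q ^+ 2]. Admissibility at [q] makes [1 - v] positive, and the three
    monotonicities then make the second expression strictly smaller. *)
Lemma fixed_point_not_lt : fixed_point gamma eta delta lam x p ->
  fixed_point gamma eta delta lam x q -> ~ admissible gamma delta lam q.
Proof.
rewrite /fixed_point /admissible => fp fq adm.
have := signal_ratio_decr; have := GCB_decr; have := GCR_incr.
have : 0 < Linf delta lam x p / (2 * Finf eta delta lam x p).
  by rewrite divr_gt0 ?mulr_gt0 ?Finf_gt0// LinfE S_gt0.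
(* [A], [B] are the signal ratios at [p], [q]; [u], [v] the values of [Gfun * CR]; [b], [e] those of
   [Gfun * CB]. *)
move: fp fq adm; set A := (_ / _); set B := (_ / _).
rewrite -!(mulrA 2^-1); set u := Gfun _ p * _; set v := Gfun _ q * _.
set b := Gfun _ p * _; set e := Gfun _ q * _ => fp fq adm A0 uv be AB.
have p2 : 0 < p ^+ 2 by rewrite exprn_gt0.
have q2 : 0 < q ^+ 2 by rewrite exprn_gt0.
have h1 : (1 - v) * (p ^+ 2 * B) <= (1 - v) * (q ^+ 2 * A).
  by rewrite ler_wpM2l ?subr_ge0 ?(ltW adm).
have h2 : (1 - v) * (q ^+ 2 * A) < (1 - u) * (q ^+ 2 * A).
  by rewrite ltr_pM2r ?ltrD2l ?ltrN2//; exact: mulr_gt0 q2 A0.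
have h3 : p ^+ 2 * q ^+ 2 = (1 - u) * (q ^+ 2 * A) + 2^-1 * (q ^+ 2 * b).
  by rewrite fp; ring.
have h4 : p ^+ 2 * q ^+ 2 = (1 - v) * (p ^+ 2 * B) + 2^-1 * (p ^+ 2 * e).
  by rewrite fq; ring.
lra.
Qed.

End uniqueness.

(** * Positivity of the risk *)

Lemma cvg_fsum (R : realType) (T : Type) (F : set_system T) (d : nat)
    (f : 'I_d -> T -> R) (a : 'I_d -> R) : Filter F ->
  (forall j, f j t @[t --> F] --> a j) ->
  \sum_(j < d) f j t @[t --> F] --> \sum_(j < d) a j.
Proof.
by move=> FF fa; apply: cvg_big => [|j _]; [exact: add_continuous|exact: fa].
Qed.

Section positivity.
Variables (R : realType) (d : nat) (gamma eta delta : R) (lam x x0 : 'I_d -> R).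
Variables V11 V12 : 'I_d -> R -> R.
Hypotheses (gamma_gt0 : 0 < gamma) (delta_gt0 : 0 < delta).
Hypothesis lam_ge0 : forall j, 0 <= lam j.
Hypothesis signal : exists j, 0 < lam j * x j ^+ 2.
Hypothesis ode : adv_ode gamma eta delta lam x x0 V11 V12.
Let Rt := Risk eta lam x V11 V12.
Let Bt := B44 V11.
Let RAt := RiskAdv eta delta lam x V11 V12.
Let qt := qratio eta lam x V11 V12.
Let g t := gamma_eff gamma delta (qt t).
Let l t := lambda_eff delta (qt t).
Hypotheses (Rt0 : 0 < Rt 0) (Bt0 : 0 < Bt 0).

Let dV11 j t := - 2 * g t * (lam j + l t) * V11 j t + 2 * g t * lam j * V12 j t
           + 2 * lam j * (gamma ^+ 2 / d%:R) * RAt t.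
Let dV12 j t := - g t * (lam j + l t) * V12 j t + g t * lam j * x j ^+ 2.

Let derV11 j (t : R) : 0 < t -> is_derive t 1 (V11 j) (dV11 j t).
Proof. by move=> t0; have [_ _ _ H _] := ode j; exact: H. Qed.

Let derV12 j (t : R) : 0 < t -> is_derive t 1 (V12 j) (dV12 j t).
Proof. by move=> t0; have [_ _ _ _ H] := ode j; exact: H. Qed.

Let cV11 j (T : R) : {within `[0, T], continuous (V11 j)}.
Proof.
have [H _ _ _ _] := ode j; apply: continuous_subspaceW H.
by apply: subset_itvl; rewrite bnd_simp.
Qed.

Let cV12 j (T : R) : {within `[0, T], continuous (V12 j)}.
Proof.
have [_ H _ _ _] := ode j; apply: continuous_subspaceW H.
by apply: subset_itvl; rewrite bnd_simp.
Qed.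

Let cRt (T : R) : {within `[0, T], continuous Rt}.
Proof.
rewrite /Rt /Risk => t; apply: cvgD; last exact: cvg_cst.
apply: cvgM; first exact: cvg_cst.
apply: cvg_fsum => j.
apply: cvgM; first exact: cvg_cst.
apply: cvgD; last exact: cvg_cst.
apply: cvgB; first exact: cV11.
apply: cvgM; first exact: cvg_cst.
exact: cV12.
Qed.

Let cBt (T : R) : {within `[0, T], continuous Bt}.
Proof. by move=> t; apply: cvg_fsum => j; exact: cV11. Qed.

(** This holds before positivity of the risk is known: [qratio] is a square root, hence nonnegative
    in all cases, and the inverse of 0 is 0. *)
Lemma adv_rate_ge0 j t : 0 <= g t * (lam j + l t).
Proof.
have q0 : 0 <= qt t by exact: sqrtr_ge0.
have c0 := ltW (cst_gt0 R).
rewrite /g /l /gamma_eff /lambda_eff mulr_ge0 ?addr_ge0 ?lam_ge0//.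
  by rewrite !(mulr_ge0, addr_ge0)// ltW.
by rewrite divr_ge0 // !(addr_ge0, mulr_ge0, invr_ge0, sqr_ge0)// ltW.
Qed.

(** Without forcing, [V12 j ^+ 2] can only decay, and it starts at 0. *)
Lemma V12_eq0 j T : 0 <= T -> x j = 0 -> V12 j T = 0.
Proof.
move=> T0 xj0; apply/eqP; rewrite -sqrf_eq0 eq_le sqr_ge0 andbT -oppr_ge0.
apply: (@barrier_ge0 _ (fun t => - V12 j t ^+ 2)
  (fun t => - (2 * V12 j t * dV12 j t)) 0 T T0).
- move=> t; apply: cvgN; apply: cvgM; exact: cV12.
- move=> t t0 _; have := derV12 j t0 => D.
  by apply: is_derive_eq; rewrite /GRing.scale/=; ring.
- move=> t t0 _ _; rewrite /dV12 xj0.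
  rewrite [leRHS](_ : _ = 2 * (g t * (lam j + l t)) * V12 j t ^+ 2); last by ring.
  by rewrite mulr_ge0 ?sqr_ge0// mulr_ge0// adv_rate_ge0.
- by have [_ _ [_ ->] _ _] := ode j; rewrite xj0 mulr0 expr0n oppr0.
Qed.

(* For [x j = 0] the inverse is 0 and the statement is [0 <= V11 j T]. *)
Lemma V12_sqr_le j T : 0 <= T -> (forall t, 0 < t -> t < T -> 0 <= RAt t) ->
  (x j ^+ 2)^-1 * V12 j T ^+ 2 <= V11 j T.
Proof.
move=> T0 RA0; rewrite -subr_ge0.
apply: (@barrier_ge0 _ (fun t => V11 j t - (x j ^+ 2)^-1 * V12 j t ^+ 2)
   (fun t => dV11 j t - (x j ^+ 2)^-1 * (2 * V12 j t * dV12 j t)) 0 T T0).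
- move=> t; apply: cvgB; first exact: cV11.
  by apply: cvgM; [exact: cvg_cst|apply: cvgM; exact: cV12].
- move=> t t0 _; have := derV12 j t0 => D; have := derV11 j t0 => D'.
  by apply: is_derive_eq; rewrite /GRing.scale/=; ring.
- move=> t t0 tT f0.
  (* The cross term of the derivative vanishes: its coefficient is 0 when [x j] is nonzero, and
     otherwise [V12 j] is 0. What remains is a damping term, nonnegative where the defect is
     negative, and the adversarial forcing. *)
  have key : V12 j t * (1 - (x j ^+ 2)^-1 * x j ^+ 2) = 0.
    have [xj|xj] := eqVneq (x j) 0; first by rewrite V12_eq0 ?mul0r// ltW.
    by rewrite mulVf ?sqrf_eq0// subrr mulr0.
  rewrite [leRHS](_ : _ =
    2 * (g t * (lam j + l t)) * - (V11 j t - (x j ^+ 2)^-1 * V12 j t ^+ 2)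
    + 2 * lam j * (gamma ^+ 2 / d%:R) * RAt t
    + 2 * g t * lam j * (V12 j t * (1 - (x j ^+ 2)^-1 * x j ^+ 2))); last first.
    by rewrite /dV11 /dV12; ring.
  rewrite key mulr0 addr0 addr_ge0//.
    rewrite mulr_ge0 ?oppr_ge0 ?(ltW f0)//.
    by apply: mulr_ge0 => //; exact: adv_rate_ge0.
  by rewrite !(sqr_ge0, mulr_ge0, divr_ge0) ?lam_ge0 ?RA0.
- have [_ _ [-> ->] _ _] := ode j.
  have [->|xj] := eqVneq (x j) 0.
    by rewrite mulr0 !expr0n mulr0 subr0 sqr_ge0.
  by rewrite exprMn mulrCA mulVf ?sqrf_eq0// mulr1 subrr.
Qed.

Let W j t := V11 j t - 2 * V12 j t + x j ^+ 2.

(** Completing the square: for nonzero [x j] the invariant bounds [W] below by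
    [((x j)^-1 * V12 - x j) ^+ 2], so equality forces the mode onto the target. *)
Let Wlemma j T : 0 <= T -> (x j ^+ 2)^-1 * V12 j T ^+ 2 <= V11 j T ->
  0 <= W j T /\ (W j T = 0 -> V11 j T = x j ^+ 2 /\ V12 j T = x j ^+ 2).
Proof.
move=> T0; rewrite /W; have [xj|xj] := eqVneq (x j) 0.
  rewrite (V12_eq0 T0 xj) xj expr0n/= !mulr0 subr0 addr0 => V0.
  by split => // ->.
set v := V12 j T; set w := V11 j T => vw.
have E : (x j ^+ 2)^-1 * v ^+ 2 - 2 * v + x j ^+ 2 = ((x j)^-1 * v - x j) ^+ 2
  by field.
have sq := sqr_ge0 ((x j)^-1 * v - x j).
split; first lra.
move=> W0; have /eqP : ((x j)^-1 * v - x j) ^+ 2 = 0 by lra.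
rewrite sqrf_eq0 subr_eq0 => /eqP vx.
have vE : v = x j ^+ 2 by rewrite expr2 -{1}vx; field.
by split => //; lra.
Qed.

Let dgt0 : 0 < d%:R :> R.
Proof. by have [j _] := signal; exact: ord_natr_gt0 j. Qed.

Let lam_pos : exists j, 0 < lam j.
Proof.
have [j lx] := signal; exists j; rewrite lt_neqAle lam_ge0 andbT.
by apply: contraTneq lx => <-; rewrite mul0r ltxx.
Qed.

Let derB (t : R) : 0 < t -> is_derive t 1 Bt (\sum_(j < d) dV11 j t).
Proof.
move=> t0; rewrite /Bt /B44.
have := is_derive_sum (fun j => derV11 j t0).
by congr is_derive; apply/funext => s; rewrite fct_sumE.
Qed.

Let derR (t : R) : 0 < t ->
  is_derive t 1 Rt (2^-1 * \sum_(j < d) lam j * (dV11 j t - 2 * dV12 j t)).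
Proof.
move=> t0; rewrite /Rt /Risk.
have Dj j : is_derive t 1
    (fun s : R => lam j * (V11 j s - 2 * V12 j s + x j ^+ 2))
    (lam j * (dV11 j t - 2 * dV12 j t)).
  have := derV12 j t0 => D; have := derV11 j t0 => D'.
  by apply: is_derive_eq; rewrite /GRing.scale/=; ring.
have := is_derive_sum Dj.
rewrite (_ : \sum_(i < d) _ = fun s =>
    \sum_(j < d) lam j * (V11 j s - 2 * V12 j s + x j ^+ 2)); last first.
  by apply/funext => s; rewrite fct_sumE.
by move=> D; apply: is_derive_eq; rewrite /GRing.scale/=; ring.
Qed.

Lemma risk_B44_gt0 t : 0 <= t -> 0 < Rt t /\ 0 < Bt t.
Proof.
move=> t0; apply/andP; rewrite -lt_min ltNge; apply/negP => fle.
have cf : {within `[0, t], continuous (fun s => Num.min (Rt s) (Bt s))}.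
  by move=> s; apply: continuous_min; [exact: cRt|exact: cBt].
have f0 : 0 < Num.min (Rt 0) (Bt 0) by rewrite lt_min Rt0.
have [T [T0 Tt fT fpos]] := segment_first_zero t0 cf f0 fle.
have Rpos s : 0 <= s -> s < T -> 0 < Rt s.
  by move=> s0 sT; have := fpos s s0 sT; rewrite lt_min => /andP[].
have Bpos s : 0 <= s -> s < T -> 0 < Bt s.
  by move=> s0 sT; have := fpos s s0 sT; rewrite lt_min => /andP[].
have RA0 s : 0 < s -> s < T -> 0 <= RAt s.
  move=> s0 sT; have Rs := Rpos s (ltW s0) sT; have Bs := Bpos s (ltW s0) sT.
  rewrite /RAt /RiskAdv -/(Rt s) -/(Bt s); move: (Rt s) (Bt s) Rs Bs => r b r0 b0.
  have c0 := cst_gt0 R.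
  by rewrite addr_ge0 ?addr_ge0 ?mulr_ge0 ?sqrtr_ge0 ?(ltW r0) ?(ltW b0)
    ?(ltW c0) ?(ltW delta_gt0).
have CS j := V12_sqr_le j (ltW T0) RA0.
have V11ge0 j : 0 <= V11 j T.
  by apply: le_trans (CS j); rewrite mulr_ge0 ?invr_ge0 ?sqr_ge0.
have RT0 : 0 <= Rt T by rewrite -fT ge_min lexx.
have BT0 : 0 <= Bt T by rewrite -fT ge_min lexx orbT.
have V0 : Bt T = 0 -> forall j, V11 j T = 0 /\ V12 j T = 0.
  move=> BT j.
  have V11_0 : V11 j T = 0 by move: BT; rewrite /Bt /B44 => /psumr_eq0P ->.
  split => //.
  have [xj|xj] := eqVneq (x j) 0; first by rewrite V12_eq0// ltW.
  have := CS j; rewrite V11_0 pmulr_rle0; last by rewrite invr_gt0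
    exprn_even_gt0//=.
  by move=> V12_le; apply/eqP; rewrite -sqrf_eq0 eq_le sqr_ge0 andbT.
(* One of the two factors under the root is zero at [T]. *)
have RAT : RAt T = Rt T + delta ^+ 2 / 2 * Bt T.
  rewrite /RAt /RiskAdv -/(Rt T) -/(Bt T) (_ : 2 * Bt T * Rt T = 0) ?sqrtr0
    ?mulr0 ?addr0//.
  by move: fT; rewrite /Num.min; case: ifP => _ ->; rewrite mulr0 ?mul0r.
(* If the risk is positive, [Bt T = 0] annihilates every [V11] and [V12], and the derivative of [Bt]
   reduces to its forcing, which is positive. *)
have [RT|RT] := eqVneq (Rt T) 0; last first.
  have BT : Bt T = 0 by move: fT RT; rewrite /Num.min; case: ifP => // _ -> /eqP.
  have := is_derive_left_zero_le0 T0 (derB T0) BT Bpos.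
  apply/negP; rewrite -ltNge.
  have E j : dV11 j T = 2 * lam j * (gamma ^+ 2 / d%:R) * Rt T.
    by rewrite /dV11 RAT BT; have [-> ->] := V0 BT j; rewrite !mulr0 !add0r addr0.
  have Rp : 0 < Rt T by rewrite lt_neqAle eq_sym RT.
  have gd : 0 < gamma ^+ 2 / d%:R by rewrite divr_gt0 ?exprn_gt0.
  apply: sumr_gt0 => [j|].
    by rewrite E; apply: mulr_ge0 => //; apply: mulr_ge0;
      [rewrite mulr_ge0|exact: ltW].
  by have [j lj] := lam_pos; exists j; rewrite E; do 2 apply: mulr_gt0 => //;
    rewrite mulr_gt0.
(* Both cannot vanish: with all [V11], [V12] zero the risk is at least half the signal energy. *)
have BT : 0 < Bt T.
  rewrite lt_neqAle eq_sym BT0 andbT; apply/eqP => BT.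
  suff : 0 < Rt T by rewrite RT ltxx.
  rewrite /Rt /Risk ltr_pwDl ?divr_ge0 ?sqr_ge0// mulr_gt0//.
  have E j : lam j * (V11 j T - 2 * V12 j T + x j ^+ 2) = lam j * x j ^+ 2.
    by have [-> ->] := V0 BT j; rewrite mulr0 subr0 add0r.
  apply: sumr_gt0 => [j|]; first by rewrite E mulr_ge0 ?sqr_ge0.
  by have [j lx] := signal; exists j; rewrite E.
have Wge0 j : 0 <= lam j * W j T by rewrite mulr_ge0//;
  have [] := Wlemma (ltW T0) (CS j).
have W0 j : lam j * W j T = 0.
  have /psumr_eq0P -> // : \sum_(j < d) lam j * W j T = 0.
  have : 0 <= \sum_(j < d) lam j * W j T by apply: sumr_ge0.
  have : 0 <= eta ^+ 2 by exact: sqr_ge0.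
  by move: RT; rewrite /Rt /Risk -/(W _ _); lra.
have := is_derive_left_zero_le0 T0 (derR T0) RT Rpos.
apply/negP; rewrite -ltNge.
(* At zero risk the modes with nonzero eigenvalue have [V11 = V12 = x ^+ 2]; the drift terms cancel
   and only the forcing through [Bt] survives. *)
have E j : lam j * (dV11 j T - 2 * dV12 j T) =
    2 * lam j ^+ 2 * (gamma ^+ 2 / d%:R) * (delta ^+ 2 / 2 * Bt T).
  have [->|lj] := eqVneq (lam j) 0; first by rewrite expr0n/= mulr0 !mul0r.
  have Wj : W j T = 0 by have /eqP := W0 j; rewrite mulf_eq0 (negbTE lj) => /eqP.
  have [_ /(_ Wj) [V1 V2]] := Wlemma (ltW T0) (CS j).
  by rewrite /dV11 /dV12 V1 V2 RAT RT; ring.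
have gd : 0 < gamma ^+ 2 / d%:R by rewrite divr_gt0 ?exprn_gt0.
have dB : 0 < delta ^+ 2 / 2 * Bt T by rewrite mulr_gt0// divr_gt0 ?exprn_gt0.
rewrite mulr_gt0//; apply: sumr_gt0 => [j|].
  rewrite E; apply: mulr_ge0; last exact: ltW.
  by apply: mulr_ge0; [rewrite mulr_ge0 ?sqr_ge0|exact: ltW].
by have [j lj] := lam_pos; exists j; rewrite E; do 2 apply: mulr_gt0 => //;
  rewrite mulr_gt0 ?exprn_gt0.
Qed.

End positivity.

(** * Convergence *)

Section asymptotics.
Variables (R : realType) (d : nat) (gamma eta delta qinf : R).
Variable lam x x0 : 'I_d -> R.
Variables V11 V12 : 'I_d -> R -> R.
Hypotheses (gamma_gt0 : 0 < gamma) (delta_gt0 : 0 < delta) (qinf_gt0 : 0 < qinf).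
Hypothesis lam_ge0 : forall j, 0 <= lam j.
Hypothesis signal : exists j, 0 < lam j * x j ^+ 2.
Hypothesis ode : adv_ode gamma eta delta lam x x0 V11 V12.
Let Rt := Risk eta lam x V11 V12.
Let Bt := B44 V11.
Let RAt := RiskAdv eta delta lam x V11 V12.
Let qt := qratio eta lam x V11 V12.
Let g t := gamma_eff gamma delta (qt t).
Let l t := lambda_eff delta (qt t).
Hypotheses (Rt0 : 0 < Rt 0) (Bt0 : 0 < Bt 0).
Hypothesis qt_cvg : qt t @[t --> +oo] --> qinf.

Let ginf := gamma_eff gamma delta qinf.
Let linf := lambda_eff delta qinf.
Let ginf_gt0 : 0 < ginf. Proof. by rewrite mulr_gt0 ?den_gt0. Qed.
Let linf_gt0 : 0 < linf. Proof. exact: lambda_eff_gt0. Qed.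
Let lam_linf_gt0 j : 0 < lam j + linf. Proof. by rewrite ltr_wpDl. Qed.

Let Rt_gt0 t : 0 <= t -> 0 < Rt t.
Proof. by move=> t0; have [] := risk_B44_gt0 gamma_gt0 delta_gt0 lam_ge0 signal
  ode Rt0 Bt0 t0. Qed.

Let Bt_gt0 t : 0 <= t -> 0 < Bt t.
Proof. by move=> t0; have [] := risk_B44_gt0 gamma_gt0 delta_gt0 lam_ge0 signal
  ode Rt0 Bt0 t0. Qed.

Lemma B44E t : 0 <= t -> Bt t = 2 * qt t ^+ 2 * Rt t.
Proof.
move=> t0; have r0 := Rt_gt0 t0; have b0 := Bt_gt0 t0.
rewrite /qt /qratio -/Rt -/Bt sqr_sqrtr; last by rewrite divr_ge0 ?mulr_ge0 ?ltW.
by field; rewrite gt_eqF.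
Qed.

(** Substituting [B44E] makes the radicand a perfect square, so the forcing is linear in the risk
    once [q] is given. *)
Lemma RiskAdvE t : 0 <= t -> RAt t = Gfun delta (qt t) * Rt t.
Proof.
move=> t0; have r0 := Rt_gt0 t0; have b0 := Bt_gt0 t0.
have q0 : 0 <= qt t by exact: sqrtr_ge0.
rewrite /RAt /RiskAdv -/(Rt t) -/(Bt t) /Gfun B44E//.
have -> : 2 * (2 * qt t ^+ 2 * Rt t) * Rt t = (2 * qt t * Rt t) ^+ 2 by ring.
rewrite sqrtr_sqr ger0_norm; first by field.
by rewrite !mulr_ge0// ltW.
Qed.

Let qt_gt0 t : 0 <= t -> 0 < qt t.
Proof. by move=> t0; rewrite sqrtr_gt0 divr_gt0 ?mulr_gt0 ?Rt_gt0 ?Bt_gt0. Qed.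

Let l_gt0 t : 0 <= t -> 0 < l t.
Proof. by move=> t0; rewrite lambda_eff_gt0 ?qt_gt0. Qed.

Let g_gt0 t : 0 <= t -> 0 < g t.
Proof. by move=> t0; rewrite mulr_gt0 ?den_gt0 ?qt_gt0. Qed.

Let g_cvg : g t @[t --> +oo] --> ginf.
Proof.
apply: cvgM; first exact: cvg_cst.
apply: cvgD; first exact: cvg_cst.
by apply: cvgM => //; exact: cvg_cst.
Qed.

Let l_cvg : l t @[t --> +oo] --> linf.
Proof.
apply: cvgM.
  apply: cvgD; first exact: cvg_cst.
  by apply: cvgM; [exact: cvg_cst|apply: cvgV => //; rewrite gt_eqF].
apply: cvgV; first by rewrite gt_eqF ?den_gt0.
apply: cvgD; first exact: cvg_cst.
by apply: cvgM => //; exact: cvg_cst.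
Qed.

Let G_cvg : Gfun delta (qt t) @[t --> +oo] --> Gfun delta qinf.
Proof.
apply: cvgD.
  apply: cvgD; first exact: cvg_cst.
  by apply: cvgM => //; exact: cvg_cst.
by apply: cvgM; [exact: cvg_cst|apply: cvgM].
Qed.

Let laml_cvg j : lam j + l t @[t --> +oo] --> lam j + linf.
Proof. by apply: cvgD => //; exact: cvg_cst. Qed.

Let ratio_cvg j : lam j / (lam j + l t) @[t --> +oo] --> lam j / (lam j + linf).
Proof. by apply: cvgM; [exact: cvg_cst|apply: cvgV => //; rewrite gt_eqF]. Qed.

Let rate_ge j : \forall t \near +oo,
  ginf * (lam j + linf) / 2 <= g t * (lam j + l t).
Proof.
have : g t * (lam j + l t) @[t --> +oo] --> ginf * (lam j + linf) by apply: cvgM.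
move=> /cvgr_ge; apply; have : 0 < ginf * (lam j + linf) by exact: mulr_gt0.
lra.
Qed.

Let rate_gt0 j : 0 < ginf * (lam j + linf) / 2.
Proof.
have : 0 < ginf * (lam j + linf) by exact: mulr_gt0.
lra.
Qed.

(** The risk enters this equation only through [q], so the ratio of forcing to rate already
    converges. *)
Lemma V12_cvg j : V12 j t @[t --> +oo] --> lam j / (lam j + linf) * x j ^+ 2.
Proof.
apply: (@relaxation_cvg _ _ (fun t => g t * (lam j + l t))
  (fun t => g t * lam j * x j ^+ 2)
  (fun t => lam j / (lam j + l t) * x j ^+ 2) _ _ (rate_gt0 j)).
- by move=> t t0; have [_ _ _ _ /(_ t t0)] := ode j; rewrite !mulNr.
- exact: rate_ge.
- near=> t; have t0 : 0 <= t by near: t; apply: nbhs_pinfty_ge; rewrite num_real.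
  by field; rewrite gt_eqF// ltr_wpDl// l_gt0.
- by apply: cvgM => //; exact: cvg_cst.
Unshelve. all: by end_near. Qed.

(** Stationary value of [V11 j] when [q] is frozen at [qinf] and the risk at [r]. *)
Let m j r := (lam j / (lam j + linf)) ^+ 2 * x j ^+ 2
  + gamma * lam j / d%:R * (Gfun delta qinf * r) / Dfun delta (lam j) qinf.

Let dgt0 : 0 < d%:R :> R.
Proof. by have [j _] := signal; exact: ord_natr_gt0 j. Qed.

(** Ratio of forcing to rate in the equation of [V11 j]. The risk is a parameter [r], so that a
    constant bound can replace the true risk. *)
Let forcing j (r : R -> R) t := lam j / (lam j + l t) * V12 j t
  + lam j * (gamma ^+ 2 / d%:R) * (Gfun delta (qt t) * r t)
    / (g t * (lam j + l t)).

Let forcing_cvg j r rinf : r t @[t --> +oo] --> rinf ->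
  forcing j r t @[t --> +oo] --> m j rinf.
Proof.
move=> rcvg; have -> : m j rinf =
    lam j / (lam j + linf) * (lam j / (lam j + linf) * x j ^+ 2)
    + lam j * (gamma ^+ 2 / d%:R) * (Gfun delta qinf * rinf)
      / (ginf * (lam j + linf)).
  rewrite /m DfunE// -/linf /ginf /gamma_eff; field.
  by rewrite !gt_eqF ?den_gt0.
apply: cvgD; first by apply: cvgM => //; exact: V12_cvg.
apply: cvgM; first by apply: cvgM; [exact: cvg_cst|exact: cvgM].
by apply: cvgV; [rewrite gt_eqF// mulr_gt0|apply: cvgM].
Qed.

Let forcingE j t : 0 <= t ->
  2 * g t * lam j * V12 j t + 2 * lam j * (gamma ^+ 2 / d%:R) * RAt t
  = forcing j Rt t * (2 * (g t * (lam j + l t))).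
Proof.
move=> t0; rewrite RiskAdvE// /forcing; field.
by rewrite !gt_eqF ?g_gt0// ltr_wpDl// l_gt0.
Qed.

Let derV11 j (t : R) : 0 < t -> is_derive t 1 (V11 j)
  (- (2 * (g t * (lam j + l t))) * V11 j t
   + (2 * g t * lam j * V12 j t + 2 * lam j * (gamma ^+ 2 / d%:R) * RAt t)).
Proof.
move=> t0; have [_ _ _ /(_ t t0) D _] := ode j.
by apply: is_derive_eq; rewrite -/(RAt t) -/(qt t) -/(g t) -/(l t); ring.
Qed.

Let rate2_ge j : \forall t \near +oo,
  ginf * (lam j + linf) / 2 <= 2 * (g t * (lam j + l t)).
Proof.
near=> t; have : ginf * (lam j + linf) / 2 <= g t * (lam j + l t) by near: t;
  exact: rate_ge.
have := rate_gt0 j; lra.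
Unshelve. all: by end_near. Qed.

Lemma V11_cvg j r : Rt t @[t --> +oo] --> r -> V11 j t @[t --> +oo] --> m j r.
Proof.
move=> rcvg; apply: (@relaxation_cvg _ (V11 j)
  (fun t => 2 * (g t * (lam j + l t)))
  (fun t => 2 * g t * lam j * V12 j t + 2 * lam j * (gamma ^+ 2 / d%:R) * RAt t)
  (forcing j Rt) _ _ (rate_gt0 j)).
- exact: derV11.
- exact: rate2_ge.
- by near=> t; apply: forcingE; near: t; apply: nbhs_pinfty_ge; rewrite num_real.
- exact: forcing_cvg.
Unshelve. all: by end_near. Qed.

(** * Affine feedback of the risk on itself *)

Let kappa := Gfun delta qinf * CR gamma delta lam qinf.

Let sum_m r : \sum_(j < d) m j r =
  Linf delta lam x qinf + Gfun delta qinf * CB gamma delta lam qinf * r.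
Proof.
rewrite /m big_split; congr (_ + _).
rewrite /CB !(mulrA, big_distrr, big_distrl)/=; apply: eq_bigr => j _.
by field; rewrite !gt_eqF ?Dfun_gt0.
Qed.

(** The part of the risk free of [V11]; it converges by [V12_cvg] before anything is known about the
    limit of the risk. *)
Let psi t :=
  2^-1 * (\sum_(j < d) lam j * (x j ^+ 2 - 2 * V12 j t)) + eta ^+ 2 / 2.
Let psiinf := 2^-1 * (\sum_(j < d)
  lam j * (x j ^+ 2 - 2 * (lam j / (lam j + linf) * x j ^+ 2))) + eta ^+ 2 / 2.

Let psi_cvg : psi t @[t --> +oo] --> psiinf.
Proof.
apply: cvgD; last exact: cvg_cst.
apply: cvgM; first exact: cvg_cst.
apply: cvg_fsum => j; apply: cvgM; first exact: cvg_cst.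
apply: cvgB; first exact: cvg_cst.
by apply: cvgM; [exact: cvg_cst|exact: V12_cvg].
Qed.

Let RtE t : Rt t = 2^-1 * (\sum_(j < d) lam j * V11 j t) + psi t.
Proof.
rewrite /Rt /Risk /psi addrA; congr (_ + _).
by rewrite -mulrDr -big_split; congr (_ * _); apply: eq_bigr => j _ /=; ring.
Qed.

(** The squares recombine through [1 - lam / (lam + l) = l / (lam + l)], which produces [Finf]. *)
Let mean_m r : 2^-1 * (\sum_(j < d) lam j * m j r) + psiinf =
  Finf eta delta lam x qinf + kappa * r.
Proof.
rewrite /psiinf /Finf -/linf addrA [RHS]addrAC; congr (_ + _);
  rewrite -mulrDr -big_split.
rewrite /kappa /CR !(mulrA, big_distrr, big_distrl)/= -big_split/=;
  apply: eq_bigr => j _.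
by rewrite /m; field; rewrite !gt_eqF ?Dfun_gt0.
Qed.

(* The factor [s] is meant to be 1 or -1, which gives upper and lower bounds. *)
Let affine_bound s r e : 0 < e ->
  (\forall t \near +oo, s * Rt t <= s * r) ->
  \forall t \near +oo,
    s * Rt t <= s * (Finf eta delta lam x qinf + kappa * r) + e.
Proof.
move=> e0 sR.
(* Total weight of the errors in the risk: half of [lam j] for each [V11 j] and 1 for [psi]. *)
pose K := 2^-1 * (\sum_(j < d) lam j) + 1.
have K0 : 0 < K by rewrite ltr_wpDl// mulr_ge0// sumr_ge0.
pose e' := e / K; have e'0 : 0 < e' by rewrite divr_gt0.
have sV : \forall t \near +oo, forall j, s * V11 j t <= s * m j r + e'.
  apply: filter_forall => j.
  apply: (@eventually_le_of_relaxation _ (fun t => s * V11 j t)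
    (fun t => 2 * (g t * (lam j + l t)))
    (fun t => s * (forcing j Rt t * (2 * (g t * (lam j + l t)))))
    (fun t => s * forcing j (fun=> r) t) _ _ _ (rate_gt0 j) e'0).
  - move=> t t0; have D := derV11 j t0.
    by apply: is_derive_eq; rewrite /GRing.scale/= forcingE ?ltW//; ring.
  - exact: rate2_ge.
  - near=> t; have t0 : 0 <= t by near: t; apply: nbhs_pinfty_ge;
      rewrite num_real.
    have a0 : 0 < g t * (lam j + l t).
      by rewrite mulr_gt0 ?g_gt0// ltr_wpDl// l_gt0.
    rewrite [leLHS]mulrA ler_pM2r ?(mulr_gt0 _ a0)// /forcing [leLHS]mulrDr
      [leRHS]mulrDr lerD2l.
    (* The [V12] parts agree; the rest is a nonnegative coefficient times [s * z], so the assumed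
       bound on [s * Rt t] passes to the forcing. *)
    have E (z : R) :
      s * (lam j * (gamma ^+ 2 / d%:R) * (Gfun delta (qt t) * z)
           / (g t * (lam j + l t)))
      = lam j * (gamma ^+ 2 / d%:R) * Gfun delta (qt t) / (g t * (lam j + l t))
        * (s * z) by ring.
    rewrite !E; apply: ler_wpM2l; last by near: t.
    rewrite divr_ge0 ?(ltW a0)// mulr_ge0 ?(ltW (Gfun_gt0 _ _)) ?qt_gt0//.
    by rewrite mulr_ge0// divr_ge0 ?sqr_ge0.
  - by apply: cvgM; [exact: cvg_cst|apply: forcing_cvg; exact: cvg_cst].
have spsi : \forall t \near +oo, s * psi t <= s * psiinf + e'.
  have : s * psi t @[t --> +oo] --> s * psiinf.
    by apply: cvgM => //; exact: cvg_cst.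
  by move=> /cvgr_le; apply; rewrite ltrDl.
near=> t.
have sVt : forall j, s * V11 j t <= s * m j r + e' by near: t.
have st : s * psi t <= s * psiinf + e' by near: t.
have Ke : K * e' = e by rewrite mulrC divfK ?gt_eqF.
rewrite -Ke /K mulrDl mul1r -mulrA mulr_suml.
rewrite RtE -mean_m mulrDr [s * (_ + psiinf)]mulrDr addrACA; apply: lerD => //.
rewrite !(mulrCA s) -mulrDr ler_pM2l// !big_distrr -big_split/=;
  apply: ler_sum => j _.
by rewrite !(mulrCA s) -mulrDr ler_wpM2l.
Unshelve. all: by end_near. Qed.

Lemma B44_cvg r : Rt t @[t --> +oo] --> r ->
  Bt t @[t --> +oo] --> 2 * qinf ^+ 2 * r.
Proof.
move=> Rcvg; have : 2 * qt t ^+ 2 * Rt t @[t --> +oo] --> 2 * qinf ^+ 2 * r.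
  by apply: cvgM => //; apply: cvgM; [exact: cvg_cst|exact: cvgM].
apply: cvg_trans; apply: near_eq_cvg; near=> t.
by rewrite B44E//; near: t; apply: nbhs_pinfty_ge; rewrite num_real.
Unshelve. all: by end_near. Qed.

Lemma RiskAdv_cvg r : Rt t @[t --> +oo] --> r ->
  RAt t @[t --> +oo] --> Gfun delta qinf * r.
Proof.
move=> Rcvg; have : Gfun delta (qt t) * Rt t @[t --> +oo] --> Gfun delta qinf * r.
  exact: cvgM.
apply: cvg_trans; apply: near_eq_cvg; near=> t.
by rewrite RiskAdvE//; near: t; apply: nbhs_pinfty_ge; rewrite num_real.
Unshelve. all: by end_near. Qed.

Hypothesis RAt_bounded : has_ubound [set RAt t | t in [set t : R | 0 <= t]].

Lemma risk_limit : kappa < 1 /\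
  Rt t @[t --> +oo] --> Finf eta delta lam x qinf / (1 - kappa).
Proof.
have [M RM] := RAt_bounded.
apply: (@cvg_of_affine_bounds _ _ _ _ M).
- exact: Finf_gt0.
- rewrite mulr_ge0 ?(ltW (Gfun_gt0 _ _))// mulr_ge0 ?divr_ge0 ?mulr_ge0
    ?(ltW gamma_gt0)//.
  by apply: sumr_ge0 => j _; rewrite divr_ge0 ?sqr_ge0// ltW// Dfun_gt0.
- by near=> t; apply/ltW/Rt_gt0; near: t; apply: nbhs_pinfty_ge; rewrite num_real.
(* [Gfun] is at least 1, so a bound on the adversarial risk bounds the risk. *)
- near=> t; have t0 : 0 <= t by near: t; apply: nbhs_pinfty_ge; rewrite num_real.
  apply: le_trans (RM _ _); last by exists t.
  rewrite RiskAdvE// ler_peMl ?(ltW (Rt_gt0 _))// /Gfun -addrA lerDl.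
  by rewrite !(sqr_ge0, addr_ge0, mulr_ge0)// ?(ltW (cst_gt0 R))
    ?(ltW (qt_gt0 _)) ?(ltW delta_gt0).
- move=> r e e0 Rr; have H : \forall t \near +oo, 1 * Rt t <= 1 * r.
    by near=> t; rewrite !mul1r; near: t.
  by have := affine_bound e0 H; apply: filterS => t; rewrite !mul1r.
- move=> r e e0 Rr; have H : \forall t \near +oo, -1 * Rt t <= -1 * r.
    by near=> t; rewrite !mulN1r lerN2; near: t.
  have := affine_bound e0 H; apply: filterS => t.
  rewrite !mulN1r; lra.
Unshelve. all: by end_near. Qed.

(** [B44] has two expressions for its limit, the sum of the stationary modes and
    [2 * qinf ^+ 2 * r]. Equating them and dividing by [2 * r] gives the equation. *)
Lemma limit_is_fixed_point : fixed_point gamma eta delta lam x qinf.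
Proof.
have [k1 Rcvg] := risk_limit; have k1' : 0 < 1 - kappa by rewrite subr_gt0.
set r := (_ / _) in Rcvg.
have F0 : 0 < Finf eta delta lam x qinf by exact: Finf_gt0.
have B1 : Bt t @[t --> +oo] --> \sum_(j < d) m j r.
  by apply: cvg_fsum => j; exact: V11_cvg.
have B2 := B44_cvg Rcvg.
have := cvg_unique (@Rhausdorff R) B1 B2.
rewrite sum_m /fixed_point -/kappa => E.
apply: (@mulfI _ (2 * r)).
  by rewrite gt_eqF// mulr_gt0// divr_gt0.
rewrite -[LHS](_ : 2 * qinf ^+ 2 * r = _); last by ring.
rewrite -E /r; field.
by rewrite !gt_eqF.
Qed.

End asymptotics.

(** * Spectral form of the signal and assembly of the result *)

Lemma innerE (R : realType) (d : nat) (u v : 'cV[R]_d) :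
  inner u v = (u^T *m v) 0 0.
Proof. by rewrite mxE; apply: eq_bigr => i _; rewrite mxE. Qed.

(** The [omega j] are the columns of a square matrix [O], so [O^T *m O = 1] also gives
    [O *m O^T = 1]. This turns positivity of the quadratic form at [Xstar] into a mode with
    [lam j * x j ^+ 2 > 0]. *)
Lemma inner_spectral (R : realType) (d : nat) (K : 'M[R]_d) (lam : 'I_d -> R)
    (omega : 'I_d -> 'cV[R]_d) (X : 'cV[R]_d) :
  orthonormal_eigenpairs K lam omega ->
  inner X (K *m X) = \sum_(j < d) lam j * inner X (omega j) ^+ 2.
Proof.
move=> [eigK orth]; pose O := \matrix_(i, j) omega j i 0.
have OtO : O^T *m O = 1%:M.
  apply/matrixP => i j; rewrite !mxE -orth; apply: eq_bigr => k _.
  by rewrite !mxE.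
have KO : K *m O = O *m diag_mx (\row_j lam j).
  apply/matrixP => i j; rewrite mul_mx_diag !mxE.
  have := congr1 (fun u : 'cV_d => u i 0) (eigK j); rewrite !mxE mulrC => <-.
  by apply: eq_bigr => k _; rewrite !mxE.
have OtX j : (O^T *m X) j 0 = inner X (omega j).
  by rewrite mxE; apply: eq_bigr => k _; rewrite !mxE mulrC.
have XE : X = O *m (O^T *m X) by rewrite mulmxA (mulmx1C OtO) mul1mx.
rewrite innerE {2}XE (mulmxA K) KO -!mulmxA mulmxA.
rewrite (_ : X^T *m O = (O^T *m X)^T); last by rewrite trmx_mul trmxK.
rewrite mxE; apply: eq_bigr => j _.
by rewrite mxE mul_diag_mx !(OtX, mxE) -/(inner _ _) mulrCA expr2.
Qed.

Theorem proposition6p2 (R : realType) (d : nat) (K : 'M[R]_d)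
    (lam : 'I_d -> R) (omega : 'I_d -> 'cV[R]_d) (Xstar X0 : 'cV[R]_d)
    (gamma eta delta qinf : R) (V11 V12 : 'I_d -> R -> R) :
  let x := fun j => inner Xstar (omega j) in
  let x0 := fun j => inner X0 (omega j) in
  let Rt := Risk eta lam x V11 V12 in
  let Bt := B44 V11 in
  let RAt := RiskAdv eta delta lam x V11 V12 in
  let qt := qratio eta lam x V11 V12 in
  covariance_matrix K ->
  orthonormal_eigenpairs K lam omega ->
  0 < gamma ->
  adv_ode gamma eta delta lam x x0 V11 V12 ->
  0 < Rt 0 ->
  0 < Bt 0 ->
  0 < inner Xstar (K *m Xstar) ->
  has_ubound [set RAt t | t in [set t : R | 0 <= t]] ->
  0 < delta ->
  0 < qinf ->
  qt t @[t --> +oo%R] --> qinf ->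
  delta <= Num.sqrt (lambda_min_plus lam / r_star) ->
  let G := Gfun delta in
  let C_R := CR gamma delta lam in
  let Rinf := Finf eta delta lam x qinf / (1 - G qinf * C_R qinf) in
  [/\ fixed_point gamma eta delta lam x qinf /\ admissible gamma delta lam qinf,
      forall q : R, 0 < q -> fixed_point gamma eta delta lam x q ->
        admissible gamma delta lam q -> q = qinf,
      Rt t @[t --> +oo%R] --> Rinf,
      Bt t @[t --> +oo%R] --> 2 * qinf ^+ 2 * Rinf
    & RAt t @[t --> +oo%R] --> G qinf * Rinf].
Proof.
move=> x x0 Rt Bt RAt qt [_ Kpsd] eigK g0 ode Rt0 Bt0 XKX RAb del0 qinf0 qcvg _
  G C_R Rinf.
have lam_ge0 j : 0 <= lam j.
  have [eigKj orth] := eigK; have := Kpsd (omega j).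
  rewrite eigKj innerE -scalemxAr mxE -innerE orth eqxx mulr1.
  by [].
have signal : exists j, 0 < lam j * x j ^+ 2.
  apply: contrapT => /forallNP nsig; move: XKX.
  rewrite (inner_spectral _ eigK) ltNge => /negP; apply.
  by apply: sumr_le0 => j _; rewrite leNgt; apply/negP; exact: nsig.
have [k1 Rcvg] := risk_limit g0 del0 qinf0 lam_ge0 signal ode Rt0 Bt0 qcvg RAb.
have fp := limit_is_fixed_point g0 del0 qinf0 lam_ge0 signal ode Rt0 Bt0 qcvg RAb.
split => //.
- move=> q q0 fq aq; have [lt|lt|//] := ltgtP q qinf.
    by have := fixed_point_not_lt g0 del0 lam_ge0 signal q0 lt fq fp.
  by have := fixed_point_not_lt g0 del0 lam_ge0 signal qinf0 lt fp fq.
- exact: (B44_cvg g0 del0 lam_ge0 signal ode Rt0 Bt0 qcvg Rcvg).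
- exact: (RiskAdv_cvg g0 del0 lam_ge0 signal ode Rt0 Bt0 qcvg Rcvg).
Qed.
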